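(* Let $S\ge 2$ and $R\ge 2$ be integers, $N=SR$, and let $n$ be an integer with $0\le n\le N$. Let $X_n$ be the number of pairs in $n$ cards selected uniformly at random from the generalized deck with $S$ suits and $R$ ranks. Then $$E[X_n]=\begin{cases}\dfrac{n}{2}-\dfrac{R}{4}+\dfrac{R}{4}\,\dfrac{\binom{N-S}{n}}{\binom{N}{n}}\;{}_2F_1(-n,-S;N-S-n+1;-1) & \text{if } 0\le n\le \dfrac N2,\\[3ex] \dfrac{n}{2}-\dfrac{R}{4}+(-1)^S\dfrac{R}{4}\,\dfrac{\binom{N-S}{N-n}}{\binom{N}{N-n}}\;{}_2F_1(n-N,-S;n-S+1;-1) & \text{if } \dfrac N2< n\le N.\end{cases}$$
   Context: Generalized deck: a set of $N=SR$ distinct cards, one for each (suit, rank) combination, with $S$ suits and $R$ ranks; thus each rank occurs on exactly $S$ cards. A set of $n$ cards is selected uniformly at random among all $n$-element subsets of the deck. A pair is a set of two cards of the same rank. The number of pairs in a set of cards is the maximum number of pairwise disjoint pairs it contains; i.e. if the set contains $y_i$ cards of rank $i$ for $i=1,\dots,R$, the number of pairs is $\sum_{i=1}^R\lfloor y_i/2\rfloor$ (e.g. four cards of one rank count as two pairs, three cards of one rank as one pair). $X_n$ is the number of pairs in the random set of $n$ cards, and $E$ denotes expectation. Pochhammer symbol: $(\alpha)_0=1$, $(\alpha)_k=\alpha(\alpha+1)\cdots(\alpha+k-1)$. Gauss hypergeometric function: ${}_2F_1(\alpha,\beta;\gamma;z)=\sum_{k=0}^\infty \frac{(\alpha)_k(\beta)_k}{(\gamma)_k}\frac{z^k}{k!}$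 (here the sums are finite since the first two arguments are non-positive integers). $\binom{a}{b}$ for integers $a\ge 0$, $b\ge0$ is the binomial coefficient, equal to $0$ if $b>a$. *)

(* Defs.v *)
From HB Require Import structures.
From mathcomp Require Import all_boot all_order all_algebra.
From mathcomp Require Import all_classical all_reals all_analysis.

Set Implicit Arguments.
Unset Strict Implicit.
Unset Printing Implicit Defensive.

Import Order.TTheory GRing.Theory Num.Theory.
Import numFieldNormedType.Exports.

Local Open Scope ring_scope.

(* A card is a (suit, rank) combination. *)
Definition card_of (S R : nat) : finType := ('I_S * 'I_R)%type.

Definition rank_of (S R : nat) (c : card_of S R) : 'I_R := c.2.

Definition is_pair (S R : nat) (p : {set card_of S R}) : bool :=
  (#|p| == 2)%N && [forall c in p, forall c' in p, rank_of c == rank_of c'].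

Definition disjoint_pairs (S R : nat) (A : {set card_of S R})
    (F : {set {set card_of S R}}) : bool :=
  finset.trivIset F && [forall p in F, is_pair p && (p \subset A)].

Definition num_pairs (S R : nat) (A : {set card_of S R}) : nat :=
  \max_(F : {set {set card_of S R}} | disjoint_pairs A F) #|F|.

(* H is a random set of cards, uniformly distributed over the n-element
   subsets of the deck. *)
Definition uniform_hand (S R n : nat) (d : measure_display)
    (T : measurableType d) (K : realType) (P : probability T K)
    (H : T -> {set card_of S R}) : Prop :=
  forall B : {set card_of S R},
    measurable [set w | H w = B]%classic /\
    P [set w | H w = B]%classic =
      (if #|B| == n
       then (#|[set C : {set card_of S R} | #|C| == n]%SET|%:R)^-1
       else 0)%:E.

Definition pochhammer (K : realType) (a : K) (k : nat) : K :=
  \prod_(i < k) (a + i%:R).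

(* The value is unspecified when the series diverges, and a term whose
   denominator (c)_k vanishes counts as 0. *)
Definition hyp2F1 (K : realType) (a b c z : K) : K :=
  limn (series (fun k : nat =>
    pochhammer a k * pochhammer b k / pochhammer c k * (z ^+ k / k`!%:R))).

(* Main.v *)
Require Import Defs.
From HB Require Import structures.
From mathcomp Require Import all_boot all_order all_algebra.
From mathcomp Require Import all_classical all_reals all_analysis.
From mathcomp Require Import measurable_realfun.
From mathcomp Require Import ring zify.

Set Implicit Arguments.
Unset Strict Implicit.
Unset Printing Implicit Defensive.

Import Order.TTheory GRing.Theory Num.Theory.
Import numFieldNormedType.Exports.

Local Open Scope ring_scope.

(** If [y] cards of the hand have a given rank, they make
[y./2 = y / 2 - 1 / 4 + (-1) ^ y / 4] pairs.  Summing over the ranks, where the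
[y]'s add up to [n], gives [n / 2 - R / 4] plus a quarter of the sum over the
ranks of [(-1) ^ y] ([num_pairsE], [natr_half]).  So only the mean of [(-1) ^ y]
over all [n]-card hands is needed.

That mean comes from a generating function: giving each card of the chosen rank
the factor [1 - X] and every other card the factor [1 + X], the sum of
[(-1) ^ y] over the [n]-card hands is the coefficient of [X ^ n] in
[(1 - X) ^ S * (1 + X) ^ (N - S)], an alternating Vandermonde sum
([sum_sign_setI]).  When [n <= N - S], its [k]-th term divided by
['C(N - S, n)] is the [k]-th term of the hypergeometric series at [-1]
([bin_hyp2F1]).

For [n > N / 2] the bound [n <= N - S] may fail.  Replacing a hand by its
complement turns [y] into [S - y] and [n] into [N - n], so the sum is
multiplied by [(-1) ^ S] ([alternating_vandermonde_compl]) and the previous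
case applies with [N - n] cards. *)

(** * Counting pairs rank by rank *)

Definition rank_class (S R : nat) (i : 'I_R) : {set card_of S R} :=
  [set c | rank_of c == i]%SET.

Lemma card_rank_class (S R : nat) (i : 'I_R) : #|rank_class S i| = S.
Proof.
have -> : rank_class S i = [set (x, i) | x in 'I_S]%SET.
  apply/setP => -[a b]; rewrite inE /rank_of /=.
  apply/eqP/imsetP => [->|[x _ [_ ->]] //].
  by exists a.
by rewrite card_imset ?card_ord // => x y [].
Qed.

Lemma sum_card_rank_class (S R : nat) (A : {set card_of S R}) :
  (\sum_(i < R) #|A :&: rank_class S i|)%N = #|A|.
Proof.
rewrite -sum1_card (partition_big (@rank_of S R) predT) //=.
apply: eq_bigr => i _; rewrite -sum1_card.
by apply: eq_bigl => c; rewrite !inE.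
Qed.

(** All the cards of a pair have one rank, so the family splits according to
rank; disjointness then makes the pairs of rank [i] cover twice as many cards of
[A] as there are such pairs. *)
Lemma disjoint_pairs_bound (S R : nat) (A : {set card_of S R})
    (F : {set {set card_of S R}}) :
  disjoint_pairs A F -> (#|F| <= \sum_(i < R) #|A :&: rank_class S i|./2)%N.
Proof.
case/andP => trivF /forall_inP pairF.
pose Fr i := [set p in F | p \subset rank_class S i]%SET.
have FrP i p : p \in Fr i -> (#|p| == 2)%N && (p \subset A :&: rank_class S i).
  rewrite inE => /andP[pF pi].
  by case/andP: (pairF _ pF) => /andP[-> _] pA; rewrite finset.subsetI pA pi.
have leFr i : (#|Fr i| <= #|A :&: rank_class S i|./2)%N.
  have trivFr : finset.trivIset (Fr i).
    by apply: trivIsetS trivF; apply/fintype.subsetP => p; rewrite inE => /andP[].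
  rewrite geq_half_double -muln2 mulnC.
  have -> : (2 * #|Fr i| = #|finset.cover (Fr i)|)%N.
    rewrite -(eqP trivFr) mulnC -sum_nat_const.
    by apply: eq_bigr => p /FrP/andP[/eqP ->].
  apply: subset_leq_card; apply/bigcupsP => p /FrP/andP[_ //].
apply: (@leq_trans (\sum_(i < R) #|Fr i|)%N); last exact: leq_sum.
have sF : F \subset (\bigcup_(i < R) Fr i)%SET.
  apply/fintype.subsetP => p pF.
  have /andP[/andP[/eqP cp /forall_inP sp] _] := pairF _ pF.
  have /card_gt0P[c cp0] : (0 < #|p|)%N by rewrite cp.
  apply/finset.bigcupP; exists (rank_of c) => //.
  rewrite inE pF; apply/fintype.subsetP => c' c'p; rewrite inE.
  by have /forall_inP := sp _ c'p; apply.
apply: leq_trans (subset_leq_card sF) _.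
elim/big_rec2: _ => [|i m B _ le]; first by rewrite cards0.
by rewrite (leq_trans (leq_card_setU _ _)) // leq_add2l.
Qed.

(** Greedy construction, by induction on [#|A|]: as long as two cards of [A]
share a rank, set them aside as a pair, which lowers the sum by exactly one. *)
Lemma disjoint_pairs_attained (S R : nat) (A : {set card_of S R}) :
  exists2 F, disjoint_pairs A F &
    (\sum_(i < R) #|A :&: rank_class S i|./2 <= #|F|)%N.
Proof.
have [m] := ubnP #|A|; elim: m A => // m IHm A ltAm.
case: (pickP (fun i : 'I_R => 1 < #|A :&: rank_class S i|)%N) => [i|small].
  case/card_gt1P => c [c' [cA c'A cc']].
  move: cA c'A; rewrite !inE => /andP[cA /eqP ci] /andP[c'A /eqP c'i].
  pose p : {set card_of S R} := [set c; c']%SET.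
  have pA : p \subset A by rewrite finset.subUset !finset.sub1set cA.
  have cp : #|p| = 2%N by rewrite cards2 cc'.
  have cAp : #|A| = (#|A :\: p| + 2)%N.
    by rewrite -cp cardsD (finset.setIidPr pA) subnK // subset_leq_card.
  have /IHm[F FP leF] : (#|A :\: p| < m)%N by lia.
  case/andP: FP => trivF /forall_inP pairF.
  have disF q : q \in F -> [disjoint p & q].
    move=> /pairF/andP[_]; rewrite finset.subsetD => /andP[_].
    by rewrite disjoint_sym.
  have p_i : p \subset rank_class S i.
    by apply/fintype.subsetP => x /set2P[] ->; rewrite inE ?ci ?c'i.
  have [trivpF pF] : finset.trivIset (p |: F)%SET /\ p \notin F.
    have F0 : finset.set0 \notin F.
      by apply/negP => /pairF/andP[/andP[]]; rewrite cards0.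
    by apply: trivIsetU1 F0 => // q /disF.
  exists (p |: F)%SET.
    apply/andP; split=> //; apply/forall_inP => q /setU1P[->|/pairF].
      rewrite pA andbT /is_pair cp eqxx.
      apply/forall_inP => x xp; apply/forall_inP => y yp.
      move/fintype.subsetP: p_i => p_i.
      by move: (p_i x xp) (p_i y yp); rewrite !inE => /eqP -> /eqP ->.
    by rewrite finset.subsetD => /andP[-> /andP[-> _]].
  rewrite cardsU1 pF; apply: leq_trans (leq_add (leqnn 1) leF).
  rewrite leq_eqVlt; apply/orP; left; apply/eqP.
  (* Spread the new pair over the ranks as an indicator of [i], so that both
     sides can be compared rank by rank. *)
  rewrite -(big_pred1_eq addn i (fun=> 1%N)) big_mkcond -big_split /=.
  apply: eq_bigr => j _; rewrite finset.setIDAC cardsD.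
  case: eqVneq => [->|ji].
    have pAi : p \subset A :&: rank_class S i by rewrite finset.subsetI pA.
    move: (subset_leq_card pAi); rewrite (finset.setIidPr pAi) cp.
    by case: #|_| => [|[|x]] //=; rewrite !subSS subn0.
  suff -> : (A :&: rank_class S j :&: p = finset.set0)%SET.
    by rewrite cards0 subn0.
  apply/setP => x; rewrite !inE; apply/negbTE/negP => /andP[/andP[_ xj]].
  rewrite -in_set2 => /(fintype.subsetP p_i); rewrite inE => xi.
  by rewrite -(eqP xi) (eqP xj) eqxx in ji.
exists finset.set0.
  rewrite /disjoint_pairs; apply/andP; split.
    by apply/finset.trivIsetP => B C; rewrite inE.
  by apply/forall_inP => B; rewrite inE.
rewrite big1 // => i _; have := small i; lia.
Qed.

Lemma num_pairsE (S R : nat) (A : {set card_of S R}) :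
  num_pairs A = (\sum_(i < R) #|A :&: rank_class S i|./2)%N.
Proof.
apply/eqP; rewrite eqn_leq; apply/andP; split.
  by apply/bigmax_leqP => F; apply: disjoint_pairs_bound.
have [F FP] := disjoint_pairs_attained A.
by move/leq_trans; apply; rewrite /num_pairs (bigD1 F) //= leq_maxl.
Qed.

(** * Alternating sums over the subsets of given size *)

Lemma coef_one_plus_scaleX_exp (K : comNzRingType) (a : K) (m k : nat) :
  ((a *: 'X + 1) ^+ m : {poly K})`_k = a ^+ k * 'C(m, k)%:R.
Proof.
rewrite exprD1n coef_sum.
under eq_bigr do rewrite exprZn coefMn coefZ coefXn.
case: (ltnP k m.+1) => km.
  rewrite (bigD1 (Ordinal km)) //= eqxx mulr1 mulr_natr big1 ?addr0 // => i ne.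
  have /negbTE -> : (k != i)%N by rewrite eq_sym.
  by rewrite mulr0 mul0rn.
rewrite bin_small // mulr0 big1 // => i _.
have /negbTE -> : (k != i)%N by rewrite neq_ltn (leq_trans (ltn_ord i) km) orbT.
by rewrite mulr0 mul0rn.
Qed.

(** Expanding the product over [c] of [1 + e c * X], where [e] is [-1] on [D] and
[1] elsewhere, selects a subset [B] and contributes
[(-1) ^ #|B :&: D| * X ^ #|B|]. The factor [1 *: 'X + 1] is left unsimplified so
that [coef_one_plus_scaleX_exp] applies to both powers. *)
Lemma sum_sign_setI_eq_coef (K : comNzRingType) (T : finType) (D : {set T})
    (n : nat) :
  \sum_(B : {set T} | #|B| == n) (-1) ^+ #|B :&: D| =
  ((- 1 *: 'X + 1) ^+ #|D| * (1 *: 'X + 1) ^+ (#|T| - #|D|) : {poly K})`_n.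
Proof.
pose e c : K := if c \in D then -1 else 1.
have -> : (- 1 *: 'X + 1) ^+ #|D| * (1 *: 'X + 1) ^+ (#|T| - #|D|) =
    \prod_c (e c *: 'X + 1) :> {poly K}.
  rewrite (bigID (mem D)) /=; congr (_ * _).
    by rewrite -prodr_const; apply: eq_bigr => c; rewrite /e => ->.
  rewrite -[#|T|](cardsC D) addKn -prodr_const.
  apply: eq_big => [c|c]; first by rewrite inE.
  by rewrite inE /e => /negbTE ->.
rewrite bigA_distr coef_sum big_mkcond /=; apply: eq_bigr => B _.
have -> : \prod_i (if i \in B then e i *: 'X else 1) =
    (-1) ^+ #|B :&: D| *: 'X^#|B| :> {poly K}.
  rewrite -big_mkcond /= scaler_prod prodr_const; congr (_ *: _).
  rewrite (bigID (mem D)) /= [X in _ * X]big1 => [|c /andP[_]]; last first.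
    by rewrite /e => /negbTE ->.
  rewrite mulr1 -prodr_const; apply: eq_big => [c|c /andP[_]].
    by rewrite inE.
  by rewrite /e => ->.
by rewrite coefZ coefXn eq_sym; case: eqP; rewrite ?mulr1 ?mulr0.
Qed.

Lemma sum_sign_setI (K : comNzRingType) (T : finType) (D : {set T}) (n : nat) :
  \sum_(B : {set T} | #|B| == n) (-1) ^+ #|B :&: D| =
  \sum_(k < n.+1) (-1) ^+ k * 'C(#|D|, k)%:R * 'C(#|T| - #|D|, n - k)%:R :> K.
Proof.
rewrite sum_sign_setI_eq_coef coefM; apply: eq_bigr => k _.
by rewrite !coef_one_plus_scaleX_exp expr1n mul1r.
Qed.

(** Complementation exchanges the two sums, and [B] and [~: B] together contain
each element of [D] once. *)
Lemma sum_sign_setI_compl (K : comNzRingType) (T : finType) (D : {set T})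
    (n : nat) : (n <= #|T|)%N ->
  \sum_(B : {set T} | #|B| == n) (-1) ^+ #|B :&: D| =
  (-1) ^+ #|D| * \sum_(B : {set T} | #|B| == (#|T| - n)%N) (-1) ^+ #|B :&: D|
    :> K.
Proof.
move=> hn; rewrite mulr_sumr.
rewrite (reindex_inj (inv_inj (@finset.setCK T))) /=.
apply: eq_big => B.
  rewrite -(cardsC B) in hn *.
  by move: #|B| #|~: B|%SET hn => a b hn; apply/eqP/eqP; lia.
move=> _; rewrite -[in RHS]signr_odd -[in LHS]signr_odd -[(-1) ^+ #|B :&: D|]signr_odd.
rewrite -signr_addb; congr (_ ^+ nat_of_bool _).
have := cardsID B D; rewrite finset.setIC finset.setDE => <-.
by rewrite oddD [(~: B :&: D)%SET]finset.setIC addbAC addbb.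
Qed.

(** Both sides count subsets of an [N]-element set with signs given by an
[S]-element subset [D]; the identity is the symmetry under complementation. *)
Lemma alternating_vandermonde_compl (K : comNzRingType) (N S n : nat) :
  (S <= N)%N -> (n <= N)%N ->
  \sum_(k < n.+1) (-1) ^+ k * 'C(S, k)%:R * 'C(N - S, n - k)%:R =
  (-1) ^+ S * \sum_(k < (N - n).+1)
    (-1) ^+ k * 'C(S, k)%:R * 'C(N - S, N - n - k)%:R :> K.
Proof.
move=> SN nN.
pose D : {set 'I_N} := [set widen_ord SN i | i in 'I_S]%SET.
have cD : #|D| = S.
  by rewrite card_imset ?card_ord // => i j [] /val_inj.
have := @sum_sign_setI_compl K _ D n.
by rewrite !sum_sign_setI cD card_ord => ->.
Qed.

(** * The hypergeometric series *)

(** The factor [(- m)_k] vanishes for [k > m], so the partial sums are eventually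
constant. *)
Lemma hyp2F1_finite (K : realType) (m : nat) (b c z : K) :
  hyp2F1 (- m%:R) b c z = \sum_(k < m.+1)
    pochhammer (- m%:R) k * pochhammer b k / pochhammer c k * (z ^+ k / k`!%:R).
Proof.
rewrite /hyp2F1; apply: lim_near_cst => //.
exists m.+1 => // j /= mj.
rewrite /series /= -(big_mkord predT (fun k => pochhammer (- m%:R) k *
  pochhammer b k / pochhammer c k * (z ^+ k / k`!%:R))) (big_cat_nat (leq0n _) mj) //=.
rewrite [X in _ + X]big_nat_cond [X in _ + X]big1 ?addr0 // => k.
move=> /andP[/andP[mk _] _].
by rewrite {1}/pochhammer (bigD1 (Ordinal mk)) //= addNr !mul0r.
Qed.

Lemma pochhammer_opp (K : realType) (m k : nat) :
  pochhammer (- m%:R : K) k = (-1) ^+ k * (m ^_ k)%:R.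
Proof.
elim: k => [|k IH]; first by rewrite /pochhammer big_ord0 mulr1.
rewrite /pochhammer big_ord_recr /= -/(pochhammer _ k) IH ffactnSr exprS.
have [km|mk] := leqP k m; last by rewrite ffact_small // mul0n mulr0 mul0r mulr0.
by rewrite natrM natrB //; ring.
Qed.

Lemma pochhammer_succ (K : realType) (a k : nat) :
  pochhammer (a%:R + 1 : K) k = ((a + k) ^_ k)%:R.
Proof.
elim: k => [|k IH]; first by rewrite /pochhammer big_ord0.
rewrite /pochhammer big_ord_recr /= -/(pochhammer _ k) IH addnS ffactSS.
by rewrite natrM -[(a + k).+1]addn1 !natrD; ring.
Qed.

(** This is the ratio of ['C(M, m - k)] to ['C(M, m)], cleared of denominators:
it is what turns Vandermonde terms into hypergeometric ones. *)
Lemma bin_sub_ffact (M m k : nat) : (m <= M)%N -> (k <= m)%N ->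
  ('C(M, m - k) * (M - m + k) ^_ k = 'C(M, m) * m ^_ k)%N.
Proof.
move=> mM; elim: k => [|k IH] km; first by rewrite subn0.
rewrite addnS ffactSS ffactnSr mulnA [RHS]mulnA -IH; last lia.
have := mul_bin_left M (m - k.+1).
rewrite (_ : (m - k.+1).+1 = m - k)%N; last lia.
rewrite (_ : M - (m - k.+1) = (M - m + k).+1)%N; last lia.
by move=> e; rewrite [('C(M, m - k.+1) * _)%N]mulnC -e [RHS]mulnC mulnA.
Qed.

(** Termwise: [(- m)_k], [(- S)_k] and [(-1) ^ k] each contribute the sign
[(-1) ^ k], and the bound [m <= M] keeps the lower parameter positive, so that
no denominator vanishes. *)
Lemma bin_hyp2F1 (K : realType) (S M m : nat) : (m <= M)%N ->
  'C(M, m)%:R * hyp2F1 (- m%:R) (- S%:R) (M%:R - m%:R + 1) (-1) =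
  \sum_(k < m.+1) (-1) ^+ k * 'C(S, k)%:R * 'C(M, m - k)%:R :> K.
Proof.
move=> mM; rewrite hyp2F1_finite mulr_sumr; apply: eq_bigr => k _.
rewrite -natrB // !pochhammer_opp pochhammer_succ.
have k0 : k`!%:R != 0 :> K by rewrite pnatr_eq0 -lt0n fact_gt0.
have f0 : ((M - m + k) ^_ k)%:R != 0 :> K.
  by rewrite pnatr_eq0 -lt0n ffact_gt0 leq_addl.
have := congr1 (fun x => x%:R : K) (bin_sub_ffact mM (ltn_ord k)).
rewrite !natrM => e.
have := congr1 (fun x => x%:R : K) (bin_ffact S k); rewrite natrM => e2.
apply: (mulIf f0); rewrite -!mulrA e -e2.
have sq : (-1) ^+ k * (-1) ^+ k = 1 :> K by rewrite -exprMn mulrNN mulr1 expr1n.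
move: ((-1) ^+ k) sq (signr_eq0 K k) => s sq s0.
rewrite -[RHS]mul1r -sq; field.
by rewrite k0 f0 s0.
Qed.

(** * Expected number of pairs *)

(** [H] has finitely many values, so [g \o H] is a finite combination of
indicators of the measurable events [H = B]; nonnegativity of [g] allows the
integral to be exchanged with the sum. *)
Lemma expectation_uniform_hand (K : realType) (S R n : nat)
    (d : measure_display) (T : measurableType d) (P : probability T K)
    (H : T -> {set card_of S R}) (g : {set card_of S R} -> K) :
  uniform_hand n P H -> (forall B, 0 <= g B) ->
  'E_P[fun w => g (H w)]%E =
  ((\sum_(B : {set card_of S R} | #|B| == n) g B) / 'C(S * R, n)%:R)%:E.
Proof.
move=> unifH g0; rewrite unlock.
have mH B : measurable [set w | H w = B]%classic by have [] := unifH B.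
transitivity (\int[P]_w (\sum_B (g B)%:E * (\1_[set w | H w = B]%classic w)%:E))%E.
  apply: eq_integral => w _.
  rewrite (bigD1 (H w)) //= indicE mem_set // mule1 big1 ?adde0 // => B BH.
  rewrite indicE memNset ?mule0 //= => HB.
  by rewrite HB eqxx in BH.
rewrite ge0_integral_sum //=; first last.
- by move=> B w _; rewrite mule_ge0 ?lee_fin // indicE; case: (_ \in _).
- by move=> B; apply: measurable_funeM; apply/measurable_EFinP; exact: measurable_indic.
rewrite mulr_suml -sumEFin [RHS]big_mkcond /=; apply: eq_bigr => B _.
rewrite ge0_integralZl //=; last first.
- by rewrite lee_fin.
- by apply/measurable_EFinP; exact: measurable_indic.
have [_ PB] := unifH B.
rewrite integral_indic // classical_sets.setIT [X in (_ * X)%E]PB.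
rewrite card_draws card_prod !card_ord.
by case: eqP => _; rewrite ?mule0.
Qed.

Lemma natr_half (K : realType) (y : nat) :
  y./2%:R = y%:R / 2 - 1 / 4 + (-1) ^+ y / 4 :> K.
Proof.
have -> : y%:R = (odd y)%:R + y./2%:R * 2 :> K.
  by rewrite -natrM -natrD muln2 odd_double_half.
by rewrite -signr_odd; case: (odd y) => /=; field.
Qed.

(** The alternating sum does not depend on the rank, since every rank has [S]
cards; hence the factor [R]. *)
Lemma sum_num_pairs (K : realType) (S R n : nat) :
  \sum_(B : {set card_of S R} | #|B| == n) (num_pairs B)%:R =
  'C(S * R, n)%:R * (n%:R / 2 - R%:R / 4) + R%:R / 4 *
    \sum_(k < n.+1) (-1) ^+ k * 'C(S, k)%:R * 'C(S * R - S, n - k)%:R :> K.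
Proof.
have cardN : #|card_of S R| = (S * R)%N by rewrite card_prod !card_ord.
pose W i : K := \sum_(B : {set card_of S R} | #|B| == n)
  (-1) ^+ #|B :&: rank_class S i|.
have WE i : W i = \sum_(k < n.+1)
    (-1) ^+ k * 'C(S, k)%:R * 'C(S * R - S, n - k)%:R.
  by rewrite /W sum_sign_setI card_rank_class cardN.
transitivity (\sum_(B : {set card_of S R} | #|B| == n) ((n%:R / 2 - R%:R / 4) +
    \sum_(i < R) (-1) ^+ #|B :&: rank_class S i| / 4) : K).
  apply: eq_bigr => B /eqP <-; rewrite num_pairsE natr_sum.
  under eq_bigr do rewrite natr_half.
  rewrite !big_split /= -mulr_suml -natr_sum sum_card_rank_class; congr (_ + _ + _).
  by rewrite sumr_const card_ord -mulr_natl; field.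
rewrite big_split /= sumr_const.
rewrite exchange_big /=.
under eq_bigr do rewrite -mulr_suml -/(W _) WE.
rewrite sumr_const card_ord.
have -> : #|[pred B : {set card_of S R} | #|B| == n]| = 'C(S * R, n).
  by rewrite -cardN -card_draws cardsE.
congr (_ + _); rewrite -[LHS]mulr_natl //.
by field.
Qed.

Theorem theorem2p1 (K : realType) (S R n : nat)
    (hS : (2 <= S)%N) (hR : (2 <= R)%N) (hn : (n <= S * R)%N)
    (d : measure_display) (T : measurableType d) (P : probability T K)
    (H : T -> {set card_of S R}) (hH : uniform_hand n P H) :
  let N := (S * R)%N in
  ('E_P[fun w => (num_pairs (H w))%:R] =
   (if n%:R <= N%:R / 2 :> K then
      n%:R / 2 - R%:R / 4
      + R%:R / 4 * ('C(N - S, n)%:R / 'C(N, n)%:R)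
        * hyp2F1 (- n%:R) (- S%:R) (N%:R - S%:R - n%:R + 1) (-1)
    else
      n%:R / 2 - R%:R / 4
      + (-1) ^+ S * (R%:R / 4) * ('C(N - S, N - n)%:R / 'C(N, N - n)%:R)
        * hyp2F1 (n%:R - N%:R) (- S%:R) (n%:R - S%:R + 1) (-1))%:E)%E.
Proof.
move=> N; rewrite (expectation_uniform_hand (g := fun B => (num_pairs B)%:R) hH) //.
rewrite sum_num_pairs -/N.
have C0 : 'C(N, n)%:R != 0 :> K by rewrite pnatr_eq0 -lt0n bin_gt0.
have NS2 : (2 * S <= N)%N by rewrite mulnC leq_mul2l hR orbT.
have SN : (S <= N)%N by lia.
have leE : (n%:R <= N%:R / 2 :> K) = (n * 2 <= N)%N.
  by rewrite ler_pdivlMr ?ltr0n // -natrM ler_nat.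
congr EFin; rewrite leE.
case: (leqP (n * 2) N) => [small|large].
  have nM : (n <= N - S)%N by lia.
  rewrite -(natrB _ SN) -(bin_hyp2F1 K S nM); field.
  by rewrite C0.
have mM : (N - n <= N - S)%N by lia.
rewrite (_ : n%:R - N%:R = - (N - n)%:R); last by rewrite natrB // opprB.
rewrite (_ : n%:R - S%:R = (N - S)%:R - (N - n)%:R); last first.
  by rewrite !natrB //; ring.
rewrite (alternating_vandermonde_compl K SN hn) -(bin_hyp2F1 K S mM) bin_sub //.
field.
by rewrite C0.
Qed.
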